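(* Let $(J_1,\ldots,J_N)$ be a Jacobi $N$-family on $\mathcal{D}_0$ with block entries $A_{n,k},B_{n,k}$ ($n\ge0$, $k=1,\ldots,N$), such that for each $n\ge0$ the $N^{n+1}\times N^{n+1}$ matrix $B_n=[B_{n,1}\ \ldots\ B_{n,N}]$ is an upper triangular invertible matrix. Then there exists a unique strictly positive unital functional $\phi$ on $\mathcal{P}_N^0=\mathbb{C}\langle Y_1,\ldots,Y_N\rangle$ such that, with $\{\varphi_\sigma\}_{\sigma\in\mathbb{F}_N^+}$ the orthogonal polynomials associated to $\phi$, the map $$W(e_\sigma)=\varphi_\sigma,\quad\sigma\in\mathbb{F}_N^+,$$ extends to a unitary operator $W:\mathcal{F}(\mathbb{C}^N)\to\mathcal{H}_\phi$ and $$J_k=W^{-1}\Psi_{\phi,k}W\ \text{ on }\mathcal{D}_0,\quad k=1,\ldots,N.$$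
   Context: $\mathbb{F}_N^+$ is the set of words on the letters $1,\ldots,N$ with empty word $\emptyset$ and length $|\sigma|$, ordered by $\preceq$: shorter words first, words of equal length lexicographically. $\mathcal{P}_N^0$ is the algebra of complex polynomials in non-commuting indeterminates $Y_1,\ldots,Y_N$; $Y_\sigma=Y_{i_1}\cdots Y_{i_k}$ for $\sigma=i_1\cdots i_k$, $Y_\emptyset=1$. $\mathcal{I}$ is the conjugate-linear involution with $\mathcal{I}(Y_{i_1}\cdots Y_{i_k})=Y_{i_k}\cdots Y_{i_1}$. A linear functional $\phi$ on $\mathcal{P}_N^0$ is strictly positive and unital if $\phi(1)=1$ and $\phi(\mathcal{I}(P)P)>0$ for $P\neq0$. Put $\langle P,Q\rangle_\phi=\phi(\mathcal{I}(Q)P)$, and let $\mathcal{H}_\phi$ be the completion of $\mathcal{P}_N^0$ for this inner product. The orthogonal polynomials associated to $\phi$ are the unique $\varphi_\sigma=\sum_{\tau\preceq\sigma}a_{\sigma,\tau}Y_\tau$ with $a_{\sigma,\sigma}>0$ and $\langle\varphi_\sigma,\varphi_\tau\rangle_\phi=\delta_{\sigma,\tau}$. $\Psi_{\phi,k}$ is the operator $P\mapsto Y_kP$ on the dense domain $\mathcal{P}_N^0\subset\mathcal{H}_\phi$. $\mathcal{F}(\mathbb{C}^N)=\bigoplus_{k\ge0}(\mathbb{C}^N)^{\otimes k}$ is the full Fock space, with orthonormal basis $e_\sigma=e_{i_1}\otimes\cdots\otimes e_{i_k}$ for $\sigma=i_1\cdots i_k$ ($e_1,\ldots,e_N$ the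 standard basis of $\mathbb{C}^N$; $e_\emptyset$ is the vacuum vector $1\in\mathbb{C}$). $\mathcal{D}_0$ is the linear span of $\{e_\sigma\}_{\sigma\in\mathbb{F}_N^+}$. A Jacobi $N$-family on $\mathcal{D}_0$ is an $N$-tuple of symmetric linear operators $J_k:\mathcal{D}_0\to\mathcal{D}_0$ whose matrices with respect to $\{e_\sigma\}$, blocked according to $|\sigma|=0,1,2,\ldots$ (words of each length in lexicographic order), are block tridiagonal: $$J_k=\begin{bmatrix}A_{0,k}&B_{0,k}^*&0&\cdots\\ B_{0,k}&A_{1,k}&B_{1,k}^*&\\ 0&B_{1,k}&A_{2,k}&\ddots\\ \vdots&&\ddots&\ddots\end{bmatrix},$$ with $A_{n,k}=A_{n,k}^*$ of size $N^n\times N^n$ and $B_{n,k}$ of size $N^{n+1}\times N^n$. ($B_{n,k}$ is the block mapping the span of the $e_\sigma$ with $|\sigma|=n$ to the span of the $e_\tau$ with $|\tau|=n+1$.)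
   Formalization: The diagonal entries of each B_n are additionally assumed positive; with ''upper triangular invertible'' alone the claim fails (N=1, A_n=0, B_n=-1 forces a negative leading coefficient of φ_1), and positivity is necessary for the conclusion. *)

(* Defs.v *)
From HB Require Import structures.
From mathcomp Require Import all_boot all_order all_algebra complex.
From mathcomp Require Import generic_quotient ring_quotient ring lra.
From mathcomp Require Import boolp classical_sets functions reals.
From mathcomp Require Import sesquilinear.
From mathcomp Require Import finmap.
From mathcomp.multinomials Require Import monalg.
Set Implicit Arguments.
Unset Strict Implicit.
Unset Printing Implicit Defensive.

(* The complex numbers are R[i] for R : realType.  In the order of R[i], 0 < z
   means that z is real and positive. *)

Import Order.TTheory GRing.Theory Num.Theory.
Local Open Scope ring_scope.
Local Open Scope quotient_scope.
Local Open Scope fset_scope.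
Local Open Scope ring_scope.

Section Completion.
Context (R : realType).
Local Notation C := (R[i]).

Section PreHilbert.
Context (V : lmodType C) (ip : {dot V for Num.conj}).

(* Convergence is expressed with the squared norm ip x x. *)
Definition cvg_ip (u : nat -> V) (l : V) :=
  forall e : C, 0 < e ->
    exists n0, forall n, (n0 <= n)%N -> ip (u n - l) (u n - l) < e.

Definition cauchy_ip (u : nat -> V) :=
  forall e : C, 0 < e ->
    exists n0, forall m n, (n0 <= m)%N -> (n0 <= n)%N ->
      ip (u m - u n) (u m - u n) < e.
End PreHilbert.

(* A Hilbert space hilb in which V embeds linearly, isometrically and densely;
   it is constructed below as hilbert_completion. *)
Record completion (V : lmodType C) (ip : {dot V for Num.conj}) := Completion {
  hilb :> lmodType C;
  hdot : {dot hilb for Num.conj};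
  hinj : {linear V -> hilb};
  hinj_isom : forall x y, hdot (hinj x) (hinj y) = ip x y;
  hinj_dense : forall h, exists u : nat -> V, cvg_ip hdot (hinj \o u) h;
  hilb_complete : forall u, cauchy_ip hdot u -> exists h, cvg_ip hdot u h }.

Definition cvgC (s : nat -> C) (l : C) :=
  forall e : C, 0 < e -> exists n0, forall n, (n0 <= n)%N -> `|s n - l| < e.

Lemma real_cauchy (s : nat -> R) :
  (forall e : R, 0 < e -> exists n0, forall m n, (n0 <= m)%N -> (n0 <= n)%N ->
     `|s m - s n| < e) ->
  exists l, forall e : R, 0 < e -> exists n0, forall n, (n0 <= n)%N -> `|s n - l| < e.
Proof.
move=> Hs.
pose E : set R := [set x : R | exists n0, forall n, (n0 <= n)%N -> x <= s n]%classic.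
have inE_ e n0 : (forall m n, (n0 <= m)%N -> (n0 <= n)%N -> `|s m - s n| < e) ->
    E (s n0 - e).
  move=> H; exists n0 => n hn; have := H n0 n (leqnn _) hn.
  by rewrite ltr_norml => /andP[_]; lra.
have ubE e n0 : (forall m n, (n0 <= m)%N -> (n0 <= n)%N -> `|s m - s n| < e) ->
    ubound E (s n0 + e).
  move=> H x [n1 Hx]; have := Hx _ (leq_maxr n0 n1).
  have := H n0 _ (leqnn _) (leq_maxl n0 n1).
  by rewrite ltr_norml => /andP[]; lra.
have hE : has_sup E.
  have [n0 H] := Hs 1 ltr01; split; first by exists (s n0 - 1); exact: inE_.
  by exists (s n0 + 1); exact: ubE.
exists (sup E) => e e0; have [n0 H] := Hs (e / 3) ltac:(lra).
have h1 := sup_upper_bound hE (inE_ _ _ H).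
have h2 := ge_sup hE.1 (ubE _ _ H).
exists n0 => n hn; have := H n n0 hn (leqnn _).
by rewrite !ltr_norml => /andP[h3 h4]; apply/andP; split; lra.
Qed.

Lemma ler_norm_ReIm (z : C) : `|z| <= (`|complex.Re z| + `|complex.Im z|)%:C%C.
Proof.
rewrite normc_def lecR -[leRHS]ger0_norm ?addr_ge0 // -sqrtr_sqr ler_wsqrtr //.
rewrite sqrrD !real_normK ?num_real //.
by have : 0 <= `|complex.Re z| * `|complex.Im z|; [exact: mulr_ge0|lra].
Qed.

Lemma normc_ge_Im (z : C) : `|complex.Im z|%:C%C <= `|z|.
Proof.
by rewrite normc_def lecR -sqrtr_sqr ler_wsqrtr // lerDr sqr_ge0.
Qed.

Lemma gt0_real (e : C) : 0 < e -> exists2 r : R, e = r%:C%C & 0 < r.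
Proof.
case: e => a b; rewrite ltcE /= => /andP[/eqP-> h].
by exists a.
Qed.

Lemma cauchy_cvgC (s : nat -> C) :
  (forall e : C, 0 < e -> exists n0, forall m n, (n0 <= m)%N -> (n0 <= n)%N ->
     `|s m - s n| < e) -> exists l, cvgC s l.
Proof.
move=> Hs.
have [a Ha] : exists l, forall e : R, 0 < e ->
    exists n0, forall n, (n0 <= n)%N -> `|complex.Re (s n) - l| < e.
  apply: real_cauchy => e e0; have [|n0 H] := Hs e%:C%C; first by rewrite ltcR.
  exists n0 => m n hm hn; rewrite -ltcR (le_lt_trans _ (H m n hm hn)) //.
  by rewrite -(raddfB (@complex.Re R : Rcomplex R -> R)) normc_ge_Re.
have [b Hb] : exists l, forall e : R, 0 < e ->
    exists n0, forall n, (n0 <= n)%N -> `|complex.Im (s n) - l| < e.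
  apply: real_cauchy => e e0; have [|n0 H] := Hs e%:C%C; first by rewrite ltcR.
  exists n0 => m n hm hn; rewrite -ltcR (le_lt_trans _ (H m n hm hn)) //.
  by rewrite -(raddfB (@complex.Im R : Rcomplex R -> R)) normc_ge_Im.
exists (a +i* b)%C => _ /gt0_real[e -> e0].
have [n1 H1] := Ha (e / 2) ltac:(lra); have [n2 H2] := Hb (e / 2) ltac:(lra).
exists (maxn n1 n2) => n; rewrite geq_max => /andP[h1 h2].
apply: le_lt_trans (ler_norm_ReIm _) _; rewrite ltcR.
have := H1 n h1; have := H2 n h2.
by case: (s n) => x y /=; lra.
Qed.

Lemma cvgC_uniq s a b : cvgC s a -> cvgC s b -> a = b.
Proof.
move=> Ha Hb; apply/eqP/negPn/negP => ab.
have e0 : 0 < `|a - b| / 2 by rewrite divr_gt0 // normr_gt0 subr_eq0.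
have [n1 H1] := Ha _ e0; have [n2 H2] := Hb _ e0.
have := ltrD (H1 _ (leq_maxl n1 n2)) (H2 _ (leq_maxr n1 n2)).
rewrite -splitr => /(le_lt_trans _) h.
suff : `|a - b| < `|a - b| by rewrite ltxx.
apply: h; rewrite [ `|s _ - a|]distrC; apply: le_trans (ler_normD _ _).
by rewrite addrA subrK.
Qed.

Lemma cvgCD s t a b : cvgC s a -> cvgC t b -> cvgC (fun n => s n + t n) (a + b).
Proof.
move=> Ha Hb e e0; have e2 : 0 < e / 2 by rewrite divr_gt0.
have [n1 H1] := Ha _ e2; have [n2 H2] := Hb _ e2.
exists (maxn n1 n2) => n; rewrite geq_max => /andP[h1 h2].
rewrite opprD addrACA (le_lt_trans (ler_normD _ _)) // [ltRHS]splitr.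
by rewrite ltrD ?H1 ?H2.
Qed.

Lemma cvgCZ s a c : cvgC s a -> cvgC (fun n => c * s n) (c * a).
Proof.
move=> Ha e e0; have c0 : 0 < `|c| + 1 by rewrite ltr_wpDl.
have [|n0 H] := Ha (e / (`|c| + 1)); first by rewrite divr_gt0.
exists n0 => n /H; rewrite ltr_pdivlMr // => h.
rewrite -mulrBr normrM (le_lt_trans _ h) // mulrC ler_wpM2l //.
by rewrite lerDl.
Qed.

Lemma cvgC_conj s a : cvgC s a -> cvgC (fun n => Num.conj (s n)) (Num.conj a).
Proof.
move=> Ha e /Ha[n0 H]; exists n0 => n /H.
by rewrite -rmorphB norm_conjC.
Qed.

Lemma cvgC_ge0 s a : (forall n, 0 <= s n) -> cvgC s a -> 0 <= a.
Proof.
move=> s0 Ha; suff -> : a = `|a| by [].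
apply: (cvgC_uniq Ha) => e /Ha[n0 H]; exists n0 => n /H.
move=> h; rewrite -{1}[s n]ger0_norm //.
by apply: le_lt_trans h; apply: ler_dist_dist.
Qed.

Lemma cvgC_const a : cvgC (fun=> a) a.
Proof. by move=> e e0; exists 0%N => n _; rewrite subrr normr0. Qed.

Lemma cvgC_near s t a : cvgC s a -> cvgC (fun n => t n - s n) 0 -> cvgC t a.
Proof.
move=> Hs /cvgCD/(_ Hs); rewrite add0r => H e /H[n0 H0].
by exists n0 => n /H0; rewrite subrK.
Qed.

Lemma cvgC_le s a b n0 :
  (forall n, (n0 <= n)%N -> s n <= b) -> cvgC s a -> a <= b.
Proof.
move=> sb Ha; rewrite -subr_ge0.
apply: (@cvgC_ge0 (fun n => b - s (n0 + n)%N)).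
  by move=> n; rewrite subr_ge0 sb ?leq_addr.
move=> e /Ha[n1 H]; exists n1 => n hn.
by rewrite opprB addrC addrA subrK -normrN opprB H // (leq_trans hn) ?leq_addl.
Qed.

Section Construction.
Context (V : lmodType C) (ip : {dot V for Num.conj}).
Implicit Types (x y z : V) (u v w : nat -> V) (e : C).

Lemma ipDl x y z : ip (x + y) z = ip x z + ip y z.
Proof. exact: linearDl. Qed.
Lemma ipDr x y z : ip x (y + z) = ip x y + ip x z.
Proof. exact: linearDr. Qed.
Lemma ipZl a x z : ip (a *: x) z = a * ip x z.
Proof. exact: linearZl_LR. Qed.
Lemma ipZr a x z : ip x (a *: z) = Num.conj a * ip x z.
Proof. exact: linearZr_LR. Qed.
Lemma ipNl x z : ip (- x) z = - ip x z.
Proof. by rewrite -scaleN1r ipZl mulN1r. Qed.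
Lemma ipNr x z : ip x (- z) = - ip x z.
Proof. by rewrite -scaleN1r ipZr rmorphN1 mulN1r. Qed.
Lemma ipC x y : ip x y = Num.conj (ip y x).
Proof. by rewrite (hermitian_subproof (s := ip)) expr0 mul1r. Qed.
Lemma ip_ge0 x : 0 <= ip x x.
Proof. exact: dnorm_ge0. Qed.

Lemma ipD2 x y : ip (x + y) (x + y) <= 2 * (ip x x + ip y y).
Proof.
rewrite -subr_ge0; apply: le_trans (ip_ge0 (x - y)) _.
by rewrite !(ipDl, ipDr, ipNl, ipNr) le_eqVlt; apply/orP; left; apply/eqP; ring.
Qed.

Lemma CauchySchwarz_ip x y : `|ip x y| ^+ 2 <= ip x x * ip y y.
Proof.
have [->|y0] := eqVneq y 0.
  by rewrite (linear0r ip) (linear0r ip) normr0 expr0n mulr0.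
have yy0 : 0 < ip y y by rewrite dnorm_gt0.
have yyR : Num.conj (ip y y) = ip y y by rewrite -ipC.
have := ip_ge0 (x - (ip x y / ip y y) *: y).
rewrite !(ipDl, ipDr, ipNl, ipNr, ipZl, ipZr). rewrite rmorphM fmorphV /= yyR.
rewrite (ipC y x) normCK => h; rewrite -subr_ge0.
have -> : ip x x * ip y y - ip x y * Num.conj (ip x y) =
   ip y y * (ip x x - Num.conj (ip x y) / ip y y * ip x y
      + - (ip x y / ip y y * (Num.conj (ip x y)))
      + ip x y / ip y y * (Num.conj (ip x y) / ip y y * ip y y)).
  by field; rewrite gt_eqF.
apply: mulr_ge0; first exact: ltW.
apply: le_trans h _; rewrite le_eqVlt; apply/orP; left; apply/eqP; ring.
Qed.

Lemma ip_small x y M e : 0 < e -> 0 < M -> ip x x < e ^+ 2 / M -> ip y y <= M ->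
  `|ip x y| < e.
Proof.
move=> e0 M0; rewrite ltr_pdivlMr // => hx hy.
have e0' := ltW e0; rewrite -(@ltr_pXn2r _ 2) ?nnegrE //.
apply: le_lt_trans (CauchySchwarz_ip x y) _; apply: le_lt_trans hx.
by rewrite ler_wpM2l ?ip_ge0.
Qed.

Definition null u := forall e, 0 < e ->
  exists n0, forall n, (n0 <= n)%N -> ip (u n) (u n) < e.

Lemma cauchy_bounded u : cauchy_ip ip u ->
  exists2 M, 0 < M & exists n0, forall n, (n0 <= n)%N -> ip (u n) (u n) <= M.
Proof.
move=> /(_ 1 ltr01)[n0 H]; exists (2 * (1 + ip (u n0) (u n0))).
  by rewrite mulr_gt0 // ltr_pwDl // ip_ge0.
exists n0 => n hn; rewrite -{1 2}[u n](subrK (u n0)).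
apply: le_trans (ipD2 _ _) _; rewrite ler_pM2l // lerD2r ltW //.
exact: H.
Qed.

Lemma nullD u v : null u -> null v -> null (fun n => u n + v n).
Proof.
move=> Hu Hv e e0; have e4 : 0 < e / 2 / 2 by rewrite !divr_gt0.
have [n1 H1] := Hu _ e4; have [n2 H2] := Hv _ e4.
exists (maxn n1 n2) => n; rewrite geq_max => /andP[h1 h2].
apply: le_lt_trans (ipD2 _ _) _; rewrite mulrC -ltr_pdivlMr //.
by rewrite [ltRHS]splitr ltrD ?H1 ?H2.
Qed.

Lemma nullZ a u : null u -> null (fun n => a *: u n).
Proof.
move=> Hu e e0; have c0 : 0 < `|a| ^+ 2 + 1 by rewrite ltr_wpDl // exprn_ge0.
have [|n0 H] := Hu (e / (`|a| ^+ 2 + 1)); first by rewrite divr_gt0.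
exists n0 => n /H; rewrite ltr_pdivlMr // => h.
rewrite dnormZ (le_lt_trans _ h) // mulrC ler_wpM2l ?ip_ge0 //.
by rewrite lerDl.
Qed.

Lemma null_cauchy u : null u -> cauchy_ip ip u.
Proof.
move=> Hu e e0; have e4 : 0 < e / 2 / 2 by rewrite !divr_gt0.
have [n0 H] := Hu _ e4; exists n0 => m n hm hn.
apply: le_lt_trans (ipD2 _ _) _; rewrite ipNl ipNr opprK mulrC -ltr_pdivlMr //.
by rewrite [ltRHS]splitr ltrD ?H.
Qed.

Lemma cauchyD u v : cauchy_ip ip u -> cauchy_ip ip v ->
  cauchy_ip ip (fun n => u n + v n).
Proof.
move=> Hu Hv e e0; have e4 : 0 < e / 2 / 2 by rewrite !divr_gt0.
have [n1 H1] := Hu _ e4; have [n2 H2] := Hv _ e4.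
exists (maxn n1 n2) => m n; rewrite !geq_max => /andP[h1 h2] /andP[h3 h4].
rewrite opprD addrACA.
apply: le_lt_trans (ipD2 _ _) _; rewrite mulrC -ltr_pdivlMr //.
by rewrite [ltRHS]splitr ltrD ?H1 ?H2.
Qed.

Lemma cauchyZ a u : cauchy_ip ip u -> cauchy_ip ip (fun n => a *: u n).
Proof.
move=> Hu e e0; have c0 : 0 < `|a| ^+ 2 + 1 by rewrite ltr_wpDl // exprn_ge0.
have [|n0 H] := Hu (e / (`|a| ^+ 2 + 1)); first by rewrite divr_gt0.
exists n0 => m n hm hn; have := H m n hm hn; rewrite ltr_pdivlMr // => h.
rewrite -scalerBr dnormZ (le_lt_trans _ h) // mulrC ler_wpM2l ?ip_ge0 //.
by rewrite lerDl.
Qed.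

Lemma cauchy_const x : cauchy_ip ip (fun=> x).
Proof. by move=> e e0; exists 0%N => m n _ _; rewrite subrr (linear0r ip). Qed.

Lemma null_ip u v : null u -> cauchy_ip ip v -> cvgC (fun n => ip (u n) (v n)) 0.
Proof.
move=> Hu /cauchy_bounded[M M0 [n1 H1]] e e0.
have [|n2 H2] := Hu (e ^+ 2 / M); first by rewrite divr_gt0 // exprn_gt0.
exists (maxn n1 n2) => n; rewrite geq_max => /andP[h1 h2].
by rewrite subr0 (@ip_small _ _ M) ?H1 ?H2.
Qed.

Lemma cauchy_ip_cvg u v : cauchy_ip ip u -> cauchy_ip ip v ->
  exists l, cvgC (fun n => ip (u n) (v n)) l.
Proof.
move=> Hu Hv; apply: cauchy_cvgC => e e0.
have [M M0 [n1 H1]] := cauchy_bounded Hu.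
have [M' M'0 [n2 H2]] := cauchy_bounded Hv.
have e2 : 0 < e / 2 by rewrite divr_gt0.
have [|n3 H3] := Hu ((e / 2) ^+ 2 / M'); first by rewrite divr_gt0 // exprn_gt0.
have [|n4 H4] := Hv ((e / 2) ^+ 2 / M); first by rewrite divr_gt0 // exprn_gt0.
exists (maxn (maxn n1 n2) (maxn n3 n4)) => m n.
rewrite !geq_max => /andP[/andP[a1 a2] /andP[a3 a4]] /andP[/andP[b1 b2] /andP[b3 b4]].
have -> : ip (u m) (v m) - ip (u n) (v n) =
  ip (u m - u n) (v m) + ip (u n) (v m - v n).
  by rewrite ipDl ipDr ipNl ipNr addrA subrK.
apply: le_lt_trans (ler_normD _ _) _; rewrite [ltRHS]splitr ltrD //.
  by rewrite (@ip_small _ _ M') ?H2 ?H3.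
by rewrite ipC norm_conjC (@ip_small _ _ M) ?H1 ?H4.
Qed.

Definition cauchyb : {pred (nat -> V)} := fun u => `[< cauchy_ip ip u >].

Lemma cauchyb_submod : submod_closed cauchyb.
Proof.
split; first by apply/asboolP; exact: (cauchy_const 0).
move=> a u v /asboolP Hu /asboolP Hv; apply/asboolP.
exact: (cauchyD (cauchyZ a Hu) Hv).
Qed.
HB.instance Definition _ :=
  GRing.isSubmodClosed.Build C (nat -> V) cauchyb cauchyb_submod.

Record cseq := CSeq { cseq_val :> nat -> V; cseqP : cseq_val \in cauchyb }.
HB.instance Definition _ := [isSub for cseq_val].
HB.instance Definition _ := [Choice of cseq by <:].
HB.instance Definition _ := [SubChoice_isSubLmodule of cseq by <:].

Definition nullb : {pred cseq} := fun f => `[< null f >].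
Lemma nullb_zmod : zmod_closed nullb.
Proof.
split.
  apply/asboolP => e e0; exists 0%N => n _; rewrite (_ : (0 : cseq) n = 0) //.
  by rewrite (linear0r ip).
move=> f g /asboolP Hu /asboolP Hv; apply/asboolP.
have := nullD Hu (nullZ (-1) Hv).
by congr null; apply/funext => n; rewrite scaleN1r.
Qed.
HB.instance Definition _ := GRing.isZmodClosed.Build cseq nullb nullb_zmod.

(* Cauchy sequences modulo null sequences. *)
Definition hcomp := Quotient.quot (nullb : zmodClosed cseq).
HB.instance Definition _ := EqQuotient.on hcomp.
HB.instance Definition _ := Choice.on hcomp.
HB.instance Definition _ := GRing.Zmodule.on hcomp.
Implicit Types (f g : cseq) (h k : hcomp) (a b : C).

Definition hpi f : hcomp := \pi_hcomp f.
Lemma hpiK h : hpi (repr h) = h. Proof. exact: reprK. Qed.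

Lemma hpi_eq f g : hpi f = hpi g <-> null (fun n => f n - g n).
Proof.
have := Quotient.idealrBE (nullb : zmodClosed cseq) f g => H; split.
  by move=> /eqP; rewrite -H => /asboolP.
by move=> n0; apply/eqP; rewrite -H; apply/asboolP.
Qed.

Lemma hpiD f g : hpi (f + g) = hpi f + hpi g. Proof. exact: Quotient.pi_add. Qed.

Lemma hpi0 : hpi 0 = 0.
Proof. by apply: (addIr (hpi 0)); rewrite -hpiD !add0r. Qed.

Definition hscale a h : hcomp := hpi (a *: repr h).
Lemma hpiZ a f : hpi (a *: f) = hscale a (hpi f).
Proof.
apply/hpi_eq; have /hpi_eq/(nullZ a) := hpiK (hpi f).
move=> /(nullZ (-1)); congr null; apply/funext => n /=.
by rewrite scaleN1r -scalerN -scaleN1r !scalerA scalerBr mulrN1 !scaleNr opprK addrC.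
Qed.

Lemma hscaleA a b h : hscale a (hscale b h) = hscale (a * b) h.
Proof. by rewrite -(hpiK h) -!hpiZ scalerA. Qed.
Lemma hscale1 : left_id 1 hscale.
Proof. by move=> h; rewrite -(hpiK h) -!hpiZ scale1r. Qed.
Lemma hscaleDr : right_distributive hscale +%R.
Proof. by move=> a h k; rewrite -(hpiK h) -(hpiK k) -!hpiZ -!hpiD -hpiZ scalerDr. Qed.
Lemma hscaleDl h : {morph hscale^~ h : a b / a + b}.
Proof. by move=> a b; rewrite -(hpiK h) -!hpiZ -hpiD scalerDl. Qed.
HB.instance Definition _ := GRing.Zmodule_isLmodule.Build C hcomp
  hscaleA hscale1 hscaleDr hscaleDl.

Definition hip h k : C := xget 0 [set l | cvgC (fun n => ip (repr h n) (repr k n)) l]%classic.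

Lemma cseq_cauchy f : cauchy_ip ip f. Proof. by have /asboolP := cseqP f. Qed.

Lemma hip_repr h k : cvgC (fun n => ip (repr h n) (repr k n)) (hip h k).
Proof.
rewrite /hip; case: xgetP => [y _ //|H].
have [l hl] := cauchy_ip_cvg (cseq_cauchy (repr h)) (cseq_cauchy (repr k)).
by case: (H l).
Qed.

Lemma hip_pi f g : cvgC (fun n => ip (f n) (g n)) (hip (hpi f) (hpi g)).
Proof.
apply: (cvgC_near (hip_repr _ _)).
have -> : (fun n => ip (f n) (g n) - ip (repr (hpi f) n) (repr (hpi g) n)) =
  (fun n => ip (f n - repr (hpi f) n) (g n) +
            Num.conj (ip (g n - repr (hpi g) n) (repr (hpi f) n))).
  apply/funext => n; rewrite -ipC ipDl ipDr ipNl ipNr addrA subrK //.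
rewrite -[0](addr0 0); apply: cvgCD.
  apply: null_ip (cseq_cauchy _); apply/hpi_eq; exact/esym/hpiK.
rewrite -(rmorph0 Num.conj) /=; apply/cvgC_conj.
apply: null_ip (cseq_cauchy _); apply/hpi_eq; exact/esym/hpiK.
Qed.

Lemma hip_linearl k : scalar (hip^~ k).
Proof.
move=> a h h'; rewrite -(hpiK h) -(hpiK h') -(hpiK k).
have := hip_pi (a *: repr h + repr h') (repr k); rewrite hpiD hpiZ => /cvgC_uniq; apply.
have := cvgCD (cvgCZ a (hip_pi (repr h) (repr k))) (hip_pi (repr h') (repr k)).
by congr cvgC; apply/funext => n; rewrite -ipZl -ipDl.
Qed.

Lemma hip_herm h k : hip h k = (-1) ^+ false * Num.conj (hip k h).
Proof.
rewrite expr0 mul1r; apply: (cvgC_uniq (hip_repr h k)).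
have := cvgC_conj (hip_repr k h).
by congr cvgC; apply/funext => n; rewrite -ipC.
Qed.

Lemma hip_bilinear : bilinear_for *%R (Num.conj \; *%R) hip.
Proof.
split; first exact: hip_linearl.
move=> h a k k' /=; rewrite hip_herm hip_linearl expr0 mul1r rmorphD rmorphM /=.
by rewrite (hip_herm h k) (hip_herm h k') !expr0 !mul1r.
Qed.
HB.instance Definition _ := bilinear_isBilinear.Build C hcomp hcomp C *%R (Num.conj \; *%R) hip hip_bilinear.
HB.instance Definition _ := isHermitianSesquilinear.Build C hcomp false Num.conj hip hip_herm.

Lemma hip_gt0 h : h != 0 -> 0 < hip h h.
Proof.
move=> h0; rewrite lt_neqAle; apply/andP; split; last first.
  by apply: (cvgC_ge0 _ (hip_repr h h)) => n; exact: ip_ge0.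
apply: contraNneq h0 => /esym hh0; apply/eqP; rewrite -(hpiK h).
rewrite -hpi0; apply/hpi_eq => e /(hip_repr h h)[m H]; exists m => n /H.
by rewrite hh0 !subr0 ger0_norm ?ip_ge0.
Qed.
HB.instance Definition _ := isDotProduct.Build C hcomp hip hip_gt0.

Lemma cauchyb_const x : (fun=> x) \in cauchyb.
Proof. by apply/asboolP; exact: cauchy_const. Qed.

Definition hinc x : hcomp := hpi (CSeq (cauchyb_const x)).

Lemma hinc_linear : linear hinc.
Proof.
move=> a x y; rewrite /hinc; have -> : CSeq (cauchyb_const (a *: x + y)) =
  a *: CSeq (cauchyb_const x) + CSeq (cauchyb_const y) by exact: val_inj.
by rewrite hpiD hpiZ.
Qed.
HB.instance Definition _ := GRing.isLinear.Build C V hcomp *:%R hinc hinc_linear.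

Lemma hinc_isom x y : hip (hinc x) (hinc y) = ip x y.
Proof. by apply: (cvgC_uniq (hip_pi _ _)); exact: cvgC_const. Qed.

Lemma hinc_cvg f : cvg_ip hip (hinc \o f) (hpi f).
Proof.
move=> e e0; have e2 : 0 < e / 2 by rewrite divr_gt0.
have [n0 H] := cseq_cauchy f e2; exists n0 => n hn /=.
apply: (@le_lt_trans _ _ (e / 2)); last first.
  by rewrite ltr_pdivrMr // ltr_pMr // (ltr1n C 2).
have -> : hinc (f n) - hpi f = hpi (CSeq (cauchyb_const (f n)) - f).
  by rewrite hpiD -[- f]scaleN1r hpiZ -[hscale _ _]/(-1 *: hpi f) scaleN1r.
apply: (cvgC_le (n0 := n0) _ (hip_pi _ _)) => m hm; exact: ltW (H n m hn hm).
Qed.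

Lemma hinc_dense h : exists u, cvg_ip hip (hinc \o u) h.
Proof. by exists (repr h); rewrite -{2}(hpiK h); exact: hinc_cvg. Qed.
End Construction.

Lemma archiC (e : C) : 0 < e ->
  exists n0, forall n, (n0 <= n)%N -> n.+1%:R^-1 < e.
Proof.
move=> /gt0_real[r -> r0].
exists (Num.bound r^-1) => n hn.
rewrite -(rmorph_nat (real_complex R)) -fmorphV ltcR.
rewrite invf_plt ?posrE // (lt_le_trans (archi_boundP _)) ?invr_ge0 ?ltW //.
by rewrite ltr_nat ltnS.
Qed.

Lemma hcomp_complete (V : lmodType C) (ip : {dot V for Num.conj})
  (H := hcomp ip) (hdot : {dot H for Num.conj} := @hip V ip) (u : nat -> H) :
  cauchy_ip hdot u -> exists h, cvg_ip hdot u h.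
Proof.
move=> Hu.
have /choice[v Hv] : forall n, exists x : V,
    hdot (u n - hinc ip x) (u n - hinc ip x) < n.+1%:R^-1.
  move=> n; have [w /(_ n.+1%:R^-1)[|m Hw]] := hinc_dense (u n).
    by rewrite invr_gt0.
  by exists (w m); rewrite -opprB linearNl linearNr opprK Hw.
have e4 e : 0 < e -> 0 < e / 2 / 2 :> C by move=> e0; rewrite !divr_gt0.
have dN (x y : H) : hdot (x - y) (x - y) = hdot (y - x) (y - x).
  by rewrite -opprB linearNl linearNr opprK.
have D2 (x y : H) e : 0 < e ->
   hdot x x < e / 2 / 2 -> hdot y y < e / 2 / 2 -> hdot (x + y) (x + y) < e.
  move=> e0 hx hy; apply: le_lt_trans (ipD2 _ _ _) _.
  by rewrite mulrC -ltr_pdivlMr // [ltRHS]splitr ltrD.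
have cv : cauchy_ip ip v.
  move=> e e0; have [n1 H1] := Hu _ (e4 _ (e4 _ e0)).
  have [n2 H2] := archiC (e4 _ (e4 _ e0)).
  have [n3 H3] := archiC (e4 _ e0).
  exists (maxn n1 (maxn n2 n3)) => m n.
  rewrite !geq_max => /and3P[a1 a2 a3] /and3P[b1 b2 b3].
  rewrite -(hinc_isom ip) linearB -/hdot.
  have -> : hinc ip (v m) - hinc ip (v n) =
    ((hinc ip (v m) - u m) + (u m - u n)) + (u n - hinc ip (v n)).
    by rewrite !addrA !subrK.
  apply: (D2) => //; last exact: lt_trans (Hv n) (H3 n b3).
  apply: D2; [exact: e4| |exact: H1].
  by rewrite dN; exact: lt_trans (Hv m) (H2 m a2).
have cvb : v \in cauchyb ip by apply/asboolP.
exists (hpi (CSeq cvb)) => e e0.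
have [n1 H1] := hinc_cvg (CSeq cvb) (e4 _ e0).
have [n2 H2] := archiC (e4 _ e0).
exists (maxn n1 n2) => n; rewrite geq_max => /andP[a1 a2].
rewrite -[u n](subrK (hinc ip (v n))) -addrA.
by apply: D2 => //; [exact: lt_trans (Hv n) (H2 n a2)|exact: H1].
Qed.

Definition hilbert_completion (V : lmodType C) (ip : {dot V for Num.conj}) :
  completion ip :=
  @Completion V ip (hcomp ip) (@hip V ip) (@hinc V ip) (@hinc_isom V ip)
    (@hinc_dense V ip) (@hcomp_complete V ip).

End Completion.

Section Words.
Context (N : nat).
Implicit Types (s t : seq 'I_N).

(* Shorter words first, words of equal length lexicographically. *)
Definition word_le s t : bool :=
  (size s < size t)%N ||
  (size s == size t) && ((s : seqlexi 'I_N) <= (t : seqlexi 'I_N))%O.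

(* The words of length n in lexicographic order, see mem_lexwords and
   lexwords_sorted. *)
Fixpoint lexwords (n : nat) : seq (seq 'I_N) :=
  if n is m.+1 then [seq k :: w | k <- enum 'I_N, w <- lexwords m]
  else [:: [::]].

Lemma size_lexwords n : size (lexwords n) = (N ^ n)%N.
Proof.
elim: n => //= n IHn.
by rewrite size_allpairs IHn size_enum_ord expnS.
Qed.

Lemma mem_lexwords n s : (s \in lexwords n) = (size s == n).
Proof.
elim: n s => [|n IHn] [|k s] //=.
  by apply/negbTE/negP => /allpairsP[[a b] []].
rewrite eqSS -IHn; apply/allpairsP/idP => [[[a b] [/= _ hb [_ ->]]]|hs] //.
by exists (k, s); rewrite mem_enum.
Qed.

Lemma lexwords_sorted n :
  sorted (fun s t => (s != t) && word_le s t) (lexwords n).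
Proof.
pose lt := fun s t : seq 'I_N => ((s : seqlexi 'I_N) < (t : seqlexi 'I_N))%O.
have ltt : transitive lt by move=> a b c; exact: lt_trans.
suff H : sorted lt (lexwords n).
  apply/(sortedP [::]) => i hi; have := (sortedP [::] H) i hi.
  rewrite /lt lt_neqAle => /andP[-> h] /=; rewrite /word_le h andbT.
  have /eqP-> : size (nth [::] (lexwords n) i) == n.
    by rewrite -mem_lexwords mem_nth // ltnW.
  have /eqP-> : size (nth [::] (lexwords n) i.+1) == n.
    by rewrite -mem_lexwords mem_nth.
  by rewrite eqxx orbT.
elim: n => //= n IHn.
have : sorted (fun i j : 'I_N => (i < j)%N) (enum 'I_N).
  by have := iota_ltn_sorted 0 N; rewrite -val_enum_ord sorted_map.
have trI : transitive (fun i j : 'I_N => (i < j)%N) by move=> ? ? ?; apply: ltn_trans.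
rewrite !sorted_pairwise // in IHn *.
elim: (enum 'I_N) => //= k ks IH /andP[hk /IH{}IH].
rewrite pairwise_cat IH andbT; apply/andP; split.
  apply/allrelP => _ _ /mapP[s hs ->] /allpairsP[[j t] [/= hj _ ->]].
  have /= kj := allP hk j hj.
  by rewrite /lt neqhead_ltxiE ?neq_ltn ?kj // ltEord.
rewrite pairwise_map; apply: sub_pairwise IHn => s t.
by rewrite /lt => st; rewrite /= ltxi_cons lexx.
Qed.

Definition wordn (n : nat) (i : 'I_(N ^ n)) : seq 'I_N := nth [::] (lexwords n) i.
End Words.

Lemma herm_of_real (C : numClosedFieldType) (V : lmodType C) (B : V -> V -> C) :
  (forall p q r, B (p + q) r = B p r + B q r) ->
  (forall p q r, B r (p + q) = B r p + B r q) ->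
  (forall a p r, B (a *: p) r = a * B p r) ->
  (forall a p r, B r (a *: p) = Num.conj a * B r p) ->
  (forall p, Num.conj (B p p) = B p p) ->
  forall p q, B p q = Num.conj (B q p).
Proof.
move=> dD dDr dZ dZr real P Q.
have := real (P + 'i *: Q); have := real (P + Q).
rewrite !(dD, dDr, dZ, dZr) !(rmorphD, rmorphM) /= conjCi !real.
set z := B P Q; set w := B Q P; set p := B P P; set q := B Q Q.
have -> : (- 'i)^* = 'i :> C by rewrite rmorphN /= conjCi opprK.
move=> h1 h2.
have k1 : z^* + w^* = z + w.
  transitivity (p + z^* + (w^* + q) - p - q); first by ring.
  by rewrite h1; ring.
have k2 : 'i * (z^* - w^*) = 'i * (w - z).
  transitivity (p + 'i * z^* + (- 'i * w^* + - 'i * ('i * q)) - p + 'i * ('i * q)).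
    by ring.
  by rewrite h2; ring.
move/(mulfI (neq0Ci _)) in k2.
have : z + z = w^* + w^*.
  transitivity ((z + w) - (w - z)); first by ring.
  by rewrite -k1 -k2; ring.
by rewrite -!mulr2n => /(pmulrnI (isT : 0 < 2)%N).
Qed.

Definition ncpoly (R : realType) (N : nat) : Type := {malg R[i][{fmonom 'I_N}]}.
HB.instance Definition _ (R : realType) N := GRing.Lalgebra.on (ncpoly R N).

(* Y_s *)
Definition ncmon (R : realType) (N : nat) (s : seq 'I_N) : ncpoly R N :=
  mkmalgU (FMonom s) 1.
Definition nccoef (R : realType) (N : nat) (P : ncpoly R N) (s : seq 'I_N) : R[i] :=
  mcoeff (FMonom s) P.

(* The involution: conjugate the coefficients and reverse the words. *)
HB.lock Definition ncinv (R : realType) (N : nat) (P : ncpoly R N) : ncpoly R N :=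
  \sum_(m <- msupp P) Num.conj (mcoeff m P) *: @ncmon R N (rev m).
Canonical ncinv_unlockable := Unlockable ncinv.unlock.

Section TensorAlgebra.
Context (R : realType) (N : nat).
Local Notation C := (R[i]).
Local Notation ncpoly := (ncpoly R N).
Local Notation ncmon := (@ncmon R N).

Lemma ncmonM (s t : seq 'I_N) : ncmon (s ++ t) = ncmon s * ncmon t.
Proof.
rewrite /ncmon [RHS]malgM_def fgmulUU mulr1; congr mkmalgU.
exact: esym (fmmulE (FMonom s) (FMonom t)).
Qed.

Lemma ncmon_nil : ncmon [::] = 1.
Proof. by congr mkmalgU; exact: esym (fmoneE _). Qed.

Lemma nccoef_inv (P : ncpoly) (s : seq 'I_N) : nccoef (ncinv P) s = Num.conj (nccoef P (rev s)).
Proof.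
rewrite /nccoef unlock raddf_sum /=.
have E (m : {fmonom 'I_N}) : mcoeff (FMonom s)
    (Num.conj (mcoeff m P) *: ncmon (rev m)) =
  if m == FMonom (rev s) then Num.conj (mcoeff m P) else 0.
  rewrite mcoeffZ mcoeffU (_ : (FMonom (rev m) == _) = (m == FMonom (rev s))).
    by case: eqP; rewrite ?mulr1 ?mulr0.
  apply/eqP/eqP => [[<-]|->]; last by rewrite /= revK.
  by rewrite revK fmK.
rewrite (eq_bigr _ (fun m _ => E m)).
have [h|h] := boolP (FMonom (rev s) \in msupp P).
  rewrite (bigD1_seq (FMonom (rev s))) ?fset_uniq //= eqxx big1 ?addr0 // => m.
  by move/negbTE->.
rewrite (mcoeff_outdom h) rmorph0 big1_seq // => m /= hm.
by case: eqP hm h => // -> ->.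
Qed.

Lemma ncpolyP (P Q : ncpoly) : (forall s : seq 'I_N, nccoef P s = nccoef Q s) -> P = Q.
Proof. by move=> H; apply/malgP => m; rewrite -[m]fmK; exact: H. Qed.

Lemma nccoef_is_linear s : scalar (fun P : ncpoly => nccoef P s).
Proof. by move=> a P Q; rewrite /nccoef mcoeffD mcoeffZ. Qed.

Lemma ncinv_is_linear a (P Q : ncpoly) : ncinv (a *: P + Q) = Num.conj a *: ncinv P + ncinv Q.
Proof.
apply: ncpolyP => s.
rewrite (nccoef_is_linear s (Num.conj a) (ncinv P) (ncinv Q)).
rewrite (nccoef_inv (a *: P + Q)) (nccoef_inv P) (nccoef_inv Q).
by rewrite (nccoef_is_linear (rev s) a P Q) rmorphD rmorphM.
Qed.

Lemma ncinvK (P : ncpoly) : ncinv (ncinv P) = P.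
Proof. by apply: ncpolyP => s; rewrite !nccoef_inv revK conjCK. Qed.

Lemma ncinvZ a (P : ncpoly) : ncinv (a *: P) = Num.conj a *: ncinv P.
Proof.
apply: ncpolyP => s; have := nccoef_inv (a *: P) s; rewrite /nccoef => ->.
by rewrite !mcoeffZ rmorphM; congr (_ * _); exact: esym (nccoef_inv P s).
Qed.

Lemma ncpoly_scalerAr a (P Q : ncpoly) : P * (a *: Q) = a *: (P * Q).
Proof.
apply/malgP => m.
have h : msupp (a *: Q) `<=` msupp Q.
  apply/fsubsetP => s; rewrite -mcoeff_neq0 mcoeffZ.
  by case: (msuppP Q) => //= _; rewrite mulr0 eqxx.
apply: etrans (mcoeffMlw m (fsubset_refl (msupp P)) h) _.
apply: esym; apply: etrans (mcoeffZ _ _ _) _.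
apply: etrans (congr1 _ (mcoeffMl P Q m)) _.
rewrite mulr_sumr; apply: eq_bigr => i _.
rewrite mulr_sumr; apply: eq_bigr => j _.
by rewrite mcoeffZ mulrnAr mulrCA.
Qed.

(* Strictly positive unital functionals. *)
Record spfunctional := SPFunctional {
  sp_fun :> {scalar ncpoly};
  sp_unital : sp_fun 1 = 1;
  sp_pos : forall P, P != 0 -> 0 < sp_fun (ncinv P * P) }.

Definition phidot (phi : spfunctional) (P Q : ncpoly) : C := phi (ncinv Q * P).

Section PhiDot.
Context (phi : spfunctional).
Local Notation dot := (phidot phi).

Lemma phidot_bilinear : bilinear_for *%R (Num.conj \; *%R) dot.
Proof.
split=> [Q a P P'|P a Q Q']; rewrite /phidot.
  by rewrite mulrDr ncpoly_scalerAr linearP.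
by rewrite ncinv_is_linear mulrDl -scalerAl linearP.
Qed.
HB.instance Definition _ :=
  bilinear_isBilinear.Build C ncpoly ncpoly C *%R (Num.conj \; *%R) dot phidot_bilinear.

Lemma phidot_gt0 P : P != 0 -> 0 < dot P P.
Proof. exact: sp_pos. Qed.

Lemma phidot_herm P Q : dot P Q = (-1) ^+ false * Num.conj (dot Q P).
Proof.
rewrite expr0 mul1r; apply: (@herm_of_real _ ncpoly dot).
- by move=> p q r; rewrite /phidot mulrDr linearD.
- move=> p q r; have := phidot_bilinear.2 r 1 p q.
  by rewrite /= scale1r rmorph1 mul1r.
- by move=> a p r; rewrite /phidot ncpoly_scalerAr linearZ.
- by move=> a p r; rewrite /phidot ncinvZ -scalerAl linearZ.
move=> p; apply: geC0_conj; have [->|/phidot_gt0/ltW //] := eqVneq p 0.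
by rewrite /phidot mulr0 linear0.
Qed.
HB.instance Definition _ := isHermitianSesquilinear.Build C ncpoly false Num.conj dot phidot_herm.
HB.instance Definition _ := isDotProduct.Build C ncpoly dot phidot_gt0.
End PhiDot.

Definition Hphi (phi : spfunctional) : completion (phidot phi) :=
  hilbert_completion (phidot phi).

(* Vectors of D0 are given by their finitely many nonzero coordinates with
   respect to e_s = e_{i_1} (x) ... (x) e_{i_k}, for s = i_1 ... i_k; the full
   Fock space is the completion of this algebraic direct sum of the tensor powers
   of C^N. *)
Definition D0 : Type := {malg C[seq 'I_N]}.
HB.instance Definition _ := GRing.Lmodule.on D0.

Definition e_ (s : seq 'I_N) : D0 := mkmalgU s 1.

Definition d0dot (x y : D0) : C := \sum_(s <- msupp x) mcoeff s x * Num.conj (mcoeff s y).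

Lemma d0dotEw (A : {fset seq 'I_N}) x y : msupp x `<=` A ->
  d0dot x y = \sum_(s <- A) mcoeff s x * Num.conj (mcoeff s y).
Proof.
move=> sA; rewrite /d0dot; apply: big_fset_incl => // s sA' h.
by rewrite (mcoeff_outdom h) mul0r.
Qed.

Lemma d0dot_bilinear : bilinear_for *%R (Num.conj \; *%R) d0dot.
Proof.
split=> [y a x x'|x a y y'] /=.
  have hx : msupp x `<=` msupp x `|` msupp x' by rewrite fsubsetUl.
  have hx' : msupp x' `<=` msupp x `|` msupp x' by rewrite fsubsetUr.
  have hs : msupp (a *: x + x') `<=` msupp x `|` msupp x'.
    apply/fsubsetP => s; rewrite -mcoeff_neq0 mcoeffD mcoeffZ in_fsetU.
    case: (msuppP x) => //=; case: (msuppP x') => //= _ _.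
    by rewrite mulr0 addr0 eqxx.
  rewrite !(d0dotEw _ hx, d0dotEw _ hx', d0dotEw _ hs) mulr_sumr -big_split.
  by apply: eq_bigr => s _ /=; rewrite mcoeffD mcoeffZ mulrDl mulrA.
rewrite /d0dot mulr_sumr -big_split; apply: eq_bigr => s _ /=.
by rewrite mcoeffD mcoeffZ rmorphD rmorphM mulrDr /= mulrCA.
Qed.
HB.instance Definition _ :=
  bilinear_isBilinear.Build C D0 D0 C *%R (Num.conj \; *%R) d0dot d0dot_bilinear.

Lemma d0dot_herm x y : d0dot x y = (-1) ^+ false * Num.conj (d0dot y x).
Proof.
rewrite expr0 mul1r (d0dotEw _ (fsubsetUl _ (msupp y))).
rewrite (d0dotEw _ (fsubsetUr (msupp x) _)) rmorph_sum /=.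
by apply: eq_bigr => s _; rewrite rmorphM /= conjCK mulrC.
Qed.
HB.instance Definition _ := isHermitianSesquilinear.Build C D0 false Num.conj d0dot d0dot_herm.

Lemma d0dot_gt0 x : x != 0 -> 0 < d0dot x x.
Proof.
move=> x0.
have h s : 0 <= mcoeff s x * Num.conj (mcoeff s x) by rewrite mul_conjC_ge0.
rewrite lt_neqAle [X in _ && X]sumr_ge0 ?andbT; last by move=> s _; exact: h.
apply: contraNneq x0 => /esym /eqP; rewrite psumr_eq0 => [/allP H|s _]; last exact: h.
apply/eqP/malgP => s; rewrite mcoeff0; have [hs|//] := msuppP.
by have /implyP/(_ isT) := H s hs; rewrite mul_conjC_eq0 => /eqP.
Qed.
HB.instance Definition _ := isDotProduct.Build C D0 d0dot d0dot_gt0.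

Lemma d0dot_e (s t : seq 'I_N) : d0dot (e_ s) (e_ t) = (s == t)%:R.
Proof.
rewrite (d0dotEw _ (msuppU_le (k := s))) big_seq_fset1 !mcoeffU eqxx mul1r.
by rewrite eq_sym; case: eqP => _; rewrite ?rmorph1 ?rmorph0.
Qed.

Definition fock : completion d0dot := hilbert_completion d0dot.

(* The block of the matrix of T that maps the span of the e_s with |s| = n to the
   span of the e_t with |t| = m. *)
Definition coef_block (T : D0 -> D0) (m n : nat) : 'M[C]_(N ^ m, N ^ n) :=
  \matrix_(i, j) mcoeff (wordn i) (T (e_ (wordn j))).

Definition jacobi_A (T : D0 -> D0) (n : nat) := coef_block T n n.
Definition jacobi_B (T : D0 -> D0) (n : nat) := coef_block T n.+1 n.

Definition jacobi_family (J : 'I_N -> {linear D0 -> D0}) : Prop :=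
  forall k,
  [/\ forall x y, d0dot (J k x) y = d0dot x (J k y),
      forall m n, (m.+1 < n)%N || (n.+1 < m)%N -> coef_block (J k) m n = 0,
      forall n, (jacobi_A (J k) n ^t Num.conj)%sesqui = jacobi_A (J k) n &
      forall n, coef_block (J k) n n.+1 = (jacobi_B (J k) n ^t Num.conj)%sesqui].

Lemma sum_expn n : (\sum_(k < N) N ^ n = N ^ n.+1)%N.
Proof. by rewrite sum_nat_const card_ord expnS. Qed.

(* B_n = [B_{n,1} ... B_{n,N}].  The column number of (k, s) in this row of blocks
   is the rank of the word k s among the words of length n.+1.  If J is the Jacobi
   family of phi, the diagonal entry of B_n at k s is
   <Y_k phi_s, phi_{k s}> = a_{s,s} / a_{k s,k s}; hence the normalization
   a_{s,s} > 0 forces the diagonal of B_n to be positive. *)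
Definition jacobi_Brow (J : 'I_N -> {linear D0 -> D0}) (n : nat) : 'M[C]_(N ^ n.+1) :=
  castmx (erefl, sum_expn n) (\mxrow_(k < N) jacobi_B (J k) n).

(* is_trig_mx means lower triangular. *)
Definition upper_triangular (n : nat) (A : 'M[C]_n) : bool := is_trig_mx A^T.

(* f is the family of orthogonal polynomials of phi: f s is a combination of the
   Y_t with t <= s, with a positive coefficient on Y_s. *)
Definition orthopoly_of (phi : spfunctional) (f : seq 'I_N -> ncpoly) : Prop :=
  [/\ forall s t, nccoef (f s) t != 0 -> word_le t s,
      forall s, 0 < nccoef (f s) s &
      forall s t, phidot phi (f s) (f t) = (s == t)%:R].

(* The graph of the unbounded operator P |-> Y_k P, whose domain is the dense
   image of ncpoly in Hphi phi. *)
Definition Psi (phi : spfunctional) (k : 'I_N) (h h' : Hphi phi) : Prop :=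
  exists2 P : ncpoly, h = hinj (Hphi phi) P & h' = hinj (Hphi phi) (ncmon [:: k] * P).

Definition unitary_with_inverse (V V' : lmodType C) (ip : {dot V for Num.conj})
   (ip' : {dot V' for Num.conj}) (H : completion ip) (K : completion ip')
   (W : {linear H -> K}) (Winv : K -> H) :=
  [/\ forall x y, hdot K (W x) (W y) = hdot H x y, cancel W Winv & cancel Winv W].

(* The last clause is J_k = W^{-1} Psi_k W on D0, including that W maps D0 into
   the domain of Psi_k. *)
Definition realizes (phi : spfunctional) (J : 'I_N -> {linear D0 -> D0}) : Prop :=
  exists f : seq 'I_N -> ncpoly, orthopoly_of phi f /\
  exists (W : {linear fock -> Hphi phi}) (Winv : Hphi phi -> fock),
  [/\ unitary_with_inverse W Winv,
      forall s, W (hinj fock (e_ s)) = hinj (Hphi phi) (f s) &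
      forall k x, exists2 h, Psi k (W (hinj fock x)) h & hinj fock (J k x) = Winv h].

End TensorAlgebra.

(* Main.v *)
(* Let ev P be the sum of P_s J_s e_empty over the words s, so that
   ev (Y_k P) = J_k (ev P).  Triangularity of the B_n and positivity of their
   diagonals say that J_k maps a vector with leading word s and positive leading
   coefficient to one with leading word k s and positive leading coefficient.
   Hence ev Y_s has leading word s, and ev is a triangular linear bijection from
   the polynomials to D0.  Symmetry of the J_k gives <ev (Q^* P), e_empty> =
   <ev P, ev Q>, so phi P = <ev P, e_empty> is strictly positive, its orthogonal
   polynomials are ev^-1 e_s, and W is the extension of the isometry ev^-1 to the
   completions.  Conversely, if W realizes J for psi, then f_empty = 1 and
   W J_k = Psi_k W force W (ev P) = P, whence psi P = <P, 1>_psi = <ev P, e_empty>. *)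

Require Import Defs.
From HB Require Import structures.
From mathcomp Require Import all_boot all_order all_algebra complex.
From mathcomp Require Import reals boolp generic_quotient sesquilinear finmap.
From mathcomp.multinomials Require Import monalg.
Set Implicit Arguments.
Unset Strict Implicit.
Unset Printing Implicit Defensive.
Import Order.TTheory GRing.Theory Num.Theory.
Local Open Scope ring_scope.

(** * The order on words and the numbering of words of equal length *)

Section Words.
Context (N : nat).
Implicit Types s t u : seq 'I_N.

(** The list [lexwords N n.+1] consists of [N] consecutive runs of [N ^ n] words, one run per first
    letter. This will match words with the columns of a row of blocks. *)
Lemma nth_lexwords_cons n (k : 'I_N) j : (j < N ^ n)%N ->
  nth [::] (lexwords N n.+1) (k * N ^ n + j) = k :: nth [::] (lexwords N n) j.
Proof.
(* The letter is replaced by its position [m], so that the induction can run over an arbitrary list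
   of letters. *)
move=> hj /=; have [m mk] : exists m, m = (k : nat) by exists (k : nat).
have : (m < size (enum 'I_N))%N by rewrite size_enum_ord mk.
have : nth k (enum 'I_N) m = k by rewrite mk nth_ord_enum.
rewrite -[in (k * _)%N]mk {mk}; elim: (enum 'I_N) m => //= i ks IH [|m] /=.
  move=> <- _; rewrite mul0n nth_cat size_map size_lexwords hj.
  by rewrite (nth_map [::]) ?size_lexwords.
move=> h hm; rewrite nth_cat size_map size_lexwords mulSn -addnA.
by rewrite ltnNge leq_addr /= addKn; exact: IH.
Qed.

Lemma index_wordP n s : size s = n -> exists i : 'I_(N ^ n), wordn i = s.
Proof.
move=> hs; have h : s \in lexwords N n by rewrite mem_lexwords hs.
have hi : (index s (lexwords N n) < N ^ n)%N by rewrite -(size_lexwords N n) index_mem.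
by exists (Ordinal hi); rewrite /wordn nth_index.
Qed.

Lemma word_le_refl s : word_le s s.
Proof. by rewrite /word_le eqxx lexx orbT. Qed.

Lemma word_le_trans : transitive (@word_le N).
Proof.
move=> s t u /orP[h|/andP[/eqP h h']] /orP[k|/andP[/eqP k k']]; rewrite /word_le.
- by rewrite (ltn_trans h k).
- by rewrite -k h.
- by rewrite h k.
- by rewrite h k eqxx (le_trans h' k') orbT.
Qed.

Lemma word_le_anti : antisymmetric (@word_le N).
Proof.
move=> s t /andP[/orP[h|/andP[/eqP h h']] /orP[k|/andP[/eqP k k']]].
- by have := ltn_trans h k; rewrite ltnn.
- by rewrite k ltnn in h.
- by rewrite h ltnn in k.
- by apply: (@le_anti _ (seqlexi 'I_N)); rewrite h' k'.
Qed.

Lemma word_lt_trans : transitive (fun s t => (s != t) && word_le s t).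
Proof.
move=> t s u /andP[st lst] /andP[tu ltu]; rewrite (word_le_trans lst ltu) andbT.
apply: contraNneq st => su; rewrite su in lst.
by apply/eqP; rewrite su; apply: word_le_anti; rewrite lst ltu.
Qed.

Lemma lexwords_uniq n : uniq (lexwords N n).
Proof.
by apply: (sorted_uniq word_lt_trans _ (lexwords_sorted N n)) => x; rewrite eqxx.
Qed.

Lemma word_le_total : total (@word_le N).
Proof.
move=> s t; rewrite /word_le; case: ltngtP => //= _.
exact: (le_total (s : seqlexi 'I_N) t).
Qed.

Lemma word_le_cons (k : 'I_N) s t : word_le (k :: s) (k :: t) = word_le s t.
Proof. by rewrite /word_le /= ltnS eqSS lexi_cons lexx. Qed.

Lemma wordn_le n (i j : 'I_(N ^ n)) : word_le (wordn i) (wordn j) = (i <= j)%N.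
Proof.
have lt_le (a b : 'I_(N ^ n)) : (a < b)%N ->
    (wordn a != wordn b) && word_le (wordn a) (wordn b).
  by move=> ab; apply: (sorted_ltn_nth word_lt_trans [::] (lexwords_sorted N n)) => //;
    rewrite inE size_lexwords.
case: (ltngtP i j) => [/lt_le/andP[]//|/lt_le/andP[ij lji]|/val_inj->]; last first.
  exact: word_le_refl.
apply/negbTE/negP => lij; case/negP: ij; apply/eqP.
by apply: word_le_anti; rewrite lij lji.
Qed.

(** An order embedding of the words into [nat], which turns induction along [word_le] into induction
    on numbers. *)
Definition word_rank s := (\sum_(m < size s) N ^ m + index s (lexwords N (size s)))%N.

Lemma word_rank_mono : {mono word_rank : s t / word_le s t >-> (s <= t)%N}.
Proof.
have lt s t : (size s < size t)%N -> (word_rank s < word_rank t)%N.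
  (* The sum bounding the rank of [s] counts the words of length at most [size s], all of which
     precede [t]. *)
  move=> st; have hs : (word_rank s < \sum_(m < (size s).+1) N ^ m)%N.
    rewrite /word_rank big_ord_recr /= ltn_add2l -[X in (_ < X)%N]size_lexwords.
    by rewrite index_mem mem_lexwords.
  apply: leq_trans hs (leq_trans _ (leq_addr _ _)).
  by rewrite -(subnKC st) big_split_ord leq_addr.
move=> s t; case: (ltngtP (size s) (size t)) => st.
- by rewrite (ltnW (lt _ _ st)) /word_le st.
- by rewrite leqNgt lt // /word_le ltnNge (ltnW st) /= gtn_eqF.
have [n tn] : exists n, size t = n by exists (size t).
rewrite tn in st; rewrite /word_rank st tn leq_add2l.
have [i <-] := index_wordP st; have [j <-] := index_wordP tn; rewrite wordn_le /wordn.
by rewrite !index_uniq ?size_lexwords ?lexwords_uniq.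
Qed.
End Words.

(** * Leading terms of the Jacobi operators on basis vectors *)

Section JacobiFamily.
Context (R : realType) (N : nat) (J : 'I_N -> {linear D0 R N -> D0 R N}).
Implicit Types s t u : seq 'I_N.

(** Column [l] of block [k] has number [k * N ^ n + l] in the row of blocks. By [nth_lexwords_cons]
    this is also the position of [k :: t] among the words of length [n.+1]. *)
Lemma jacobi_BrowE n (i j : 'I_(N ^ n.+1)) (k : 'I_N) t :
  wordn j = k :: t -> jacobi_Brow J n i j = mcoeff (wordn i) (J k (e_ R t)).
Proof.
move=> hj; have st : size t = n.
  have : size (wordn j) = n.+1.
    by apply/eqP; rewrite -mem_lexwords mem_nth // size_lexwords.
  by rewrite hj => -[].
have [l hl] := index_wordP st.
have jE : cast_ord (esym (sum_expn N n)) j = @tagnat.Rank N (fun=> N ^ n)%N k l.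
  apply: val_inj; apply: etrans (esym (@tagnat.RankEsum N (fun=> N ^ n)%N k l)) => /=.
  have -> : (\sum_(i < N | (i < k)%N) N ^ n = k * N ^ n)%N.
    by rewrite (big_ord_narrow (ltnW (ltn_ord k))) sum_nat_const card_ord.
  have kl : (k * N ^ n + l < N ^ n.+1)%N.
    apply: leq_trans (_ : k.+1 * N ^ n <= _)%N; first by rewrite mulSn addnC ltn_add2r.
    by rewrite expnS leq_mul2r ltn_ord orbT.
  apply/eqP; rewrite -(nth_uniq [::] _ _ (lexwords_uniq N n.+1)) ?size_lexwords //.
  by rewrite nth_lexwords_cons // -/(wordn l) hl -hj.
rewrite /jacobi_Brow castmxE /= jE mxE mxE [wordn (tagnat.sig2 _)](_ : _ = t).
  by rewrite tagnat.Rank1K; congr (mcoeff (nth _ _ _)).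
by rewrite tagnat.Rank2K -hl.
Qed.

Hypothesis block0 : forall k m n, (m.+1 < n)%N || (n.+1 < m)%N -> coef_block (J k) m n = 0.
Hypothesis B_triangular : forall n : nat, upper_triangular (jacobi_Brow J n).
Hypothesis B_diag_pos : forall (n : nat) (i : 'I_(N ^ n.+1)), 0 < jacobi_Brow J n i i.

(** Tridiagonality excludes words longer than [k :: t], and triangularity of the row of blocks
    excludes later words of the same length. The coefficient at [k :: t] is a diagonal entry. *)
Lemma jacobi_basis_lead k t :
  (forall u, mcoeff u (J k (e_ R t)) != 0 -> word_le u (k :: t)) /\
  0 < mcoeff (k :: t) (J k (e_ R t)).
Proof.
have [j hj] := index_wordP (erefl (size (k :: t))); split => [u|]; last first.
  by rewrite -[X in mcoeff X]hj -(jacobi_BrowE _ hj).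
case: (ltngtP (size u) (size t).+1) => su.
- by rewrite /word_le /= su.
- have [l hl] := index_wordP (erefl (size u)).
  have [m hm] := index_wordP (erefl (size t)).
  have /matrixP/(_ l m) := @block0 k (size u) (size t) (introT orP (or_intror su)).
  by rewrite !mxE hl hm => ->; rewrite eqxx.
have [l hl] := index_wordP su; rewrite -hl -hj wordn_le -(jacobi_BrowE _ hj).
rewrite leqNgt; apply: contra => lj.
by have /is_trig_mxP/(_ _ _ lj) := B_triangular (size t); rewrite mxE => ->.
Qed.

End JacobiFamily.

(** * Linear maps out of free modules, and expansions in the bases *)

Section MalgLift.
Context (C : comNzRingType) (K : choiceType) (V : lmodType C) (h : K -> V).

(** The linear extension of [h] from the basis. It serves both for evaluation of polynomials and for
    the inverse map on [D0]. *)
Definition malg_lift (g : {malg C[K]}) : V := \sum_(k <- msupp g) mcoeff k g *: h k.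

Lemma malg_liftEw (A : {fset K}) g : (msupp g `<=` A)%fset ->
  malg_lift g = \sum_(k <- A) mcoeff k g *: h k.
Proof.
move=> gA; apply: big_fset_incl => // k _ kg.
by rewrite (mcoeff_outdom kg) scale0r.
Qed.

Lemma malg_lift_is_linear : linear malg_lift.
Proof.
move=> a f g; pose A := (msupp f `|` msupp g)%fset.
have hf : (msupp f `<=` A)%fset by rewrite fsubsetUl.
have hg : (msupp g `<=` A)%fset by rewrite fsubsetUr.
have hs : (msupp (a *: f + g) `<=` A)%fset.
  apply: fsubset_trans (msuppD_le _ _) _.
  by rewrite fsetSU // msuppZ_le.
rewrite (malg_liftEw hf) (malg_liftEw hg) (malg_liftEw hs) scaler_sumr -big_split.
by apply: eq_bigr => k _; rewrite mcoeffD mcoeffZ scalerDl scalerA.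
Qed.
HB.instance Definition _ :=
  GRing.isLinear.Build C {malg C[K]} V *:%R malg_lift malg_lift_is_linear.

Lemma malg_liftU k : malg_lift (mkmalgU k 1) = h k.
Proof.
by rewrite (malg_liftEw (msuppU_le (k := k))) big_seq_fset1 mcoeffUU scale1r.
Qed.
End MalgLift.

Lemma D0_basis (R : realType) N (x : D0 R N) :
  x = \sum_(t <- msupp x) mcoeff t x *: e_ R t.
Proof.
rewrite [LHS]monalgE; apply: eq_bigr => t _; apply/malgP => u.
by rewrite mcoeffZ !mcoeffU mulr_natr.
Qed.

Lemma ncpoly_basis (R : realType) N (P : ncpoly R N) :
  P = \sum_(m <- msupp P) mcoeff m P *: ncmon R m.
Proof.
rewrite [LHS]monalgE; apply: eq_bigr => t _; apply/malgP => u.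
by rewrite mcoeffZ !mcoeffU mulr_natr fmK.
Qed.

Lemma nccoef_mon (R : realType) N (s t : seq 'I_N) : nccoef (ncmon R s) t = (s == t)%:R.
Proof. by rewrite /nccoef mcoeffU. Qed.

(** * Leading words and triangular linear maps *)

Section Leading.
Context (R : realType) (N : nat).
Implicit Types (s t u : seq 'I_N) (x y : D0 R N) (P Q : ncpoly R N).

(** Stated for coefficient families, so that it applies to vectors of [D0] and to polynomials
    alike. *)
Definition leading (c : seq 'I_N -> R[i]) s :=
  (forall t, c t != 0 -> word_le t s) /\ 0 < c s.

(** Prefixing [k] preserves the order of words, so the leading terms of the [J k (e_ R t)] are
    ordered as the words [t] themselves. *)
Lemma jacobi_lead (J : 'I_N -> {linear D0 R N -> D0 R N}) :
  (forall k m n, (m.+1 < n)%N || (n.+1 < m)%N -> coef_block (J k) m n = 0) ->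
  (forall n : nat, upper_triangular (jacobi_Brow J n)) ->
  (forall (n : nat) (i : 'I_(N ^ n.+1)), 0 < jacobi_Brow J n i i) ->
  forall k x s, leading (mcoeff^~ x) s -> leading (mcoeff^~ (J k x)) (k :: s).
Proof.
move=> block0 Btri Bpos k x s [xs x0].
have JE u : mcoeff u (J k x) = \sum_(t <- msupp x) mcoeff t x * mcoeff u (J k (e_ R t)).
  rewrite [in LHS](D0_basis x) linear_sum raddf_sum /=.
  by apply: eq_bigr => t _; rewrite linearZ mcoeffZ.
have lead t := jacobi_basis_lead block0 Btri Bpos k t.
split=> [u|]; rewrite JE; last first.
  rewrite (bigD1_seq s) ?fset_uniq -?mcoeff_neq0 ?gt_eqF //= big1_seq ?addr0.
    by rewrite mulr_gt0 // (lead s).2.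
  (* A term with [t] strictly below [s] cannot reach [k :: s], since that would force [s] to precede
     [t]. *)
  move=> t /andP[ts]; rewrite -mcoeff_neq0 => /xs lts.
  have [|/(lead t).1] := eqVneq (mcoeff (k :: s) (J k (e_ R t))) 0.
    by move=> ->; rewrite mulr0.
  rewrite word_le_cons => lst; case/eqP: ts.
  by apply: word_le_anti; rewrite lts lst.
apply: contraR => us; rewrite big1_seq // => t /andP[_].
rewrite -mcoeff_neq0 => /xs lts.
have [->|/(lead t).1 h] := eqVneq (mcoeff u (J k (e_ R t))) 0; first by rewrite mulr0.
by case/negP: us; apply: word_le_trans h _; rewrite word_le_cons.
Qed.

Lemma word_le_max (r : seq (seq 'I_N)) : r != [::] ->
  exists2 s, s \in r & forall t, t \in r -> word_le t s.
Proof.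
elim: r => // s [|t r] IH _.
  by exists s; rewrite ?mem_head // => t /[!inE]/eqP->; apply: word_le_refl.
have [//|m hm mx] := IH; have [h|h] := orP (word_le_total s m).
  exists m; first by rewrite inE hm orbT.
  by move=> u; rewrite inE => /orP[/eqP->|/mx].
exists s; first exact: mem_head.
move=> u; rewrite inE => /orP[/eqP->|/mx/word_le_trans]; [exact: word_le_refl|exact].
Qed.

Context (f : {linear ncpoly R N -> D0 R N}).
Hypothesis f_lead : forall s, leading (mcoeff^~ (f (ncmon R s))) s.

Lemma triangular_coef P u :
  mcoeff u (f P) = \sum_(m <- msupp P) mcoeff m P * mcoeff u (f (ncmon R m)).
Proof.
rewrite [in LHS](ncpoly_basis P) linear_sum raddf_sum.
by apply: eq_bigr => m _; rewrite linearZ; apply: mcoeffZ.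
Qed.

(** At the largest word [m] of the support of [P], only the term of [m] contributes to [f P], with a
    positive factor. *)
Lemma triangular_inj P : f P = 0 -> P = 0.
Proof.
move=> fP0; apply/eqP/negPn/negP => P0.
have [|s] := @word_le_max [seq fmonom_val m | m <- msupp P].
  apply: contra P0 => /eqP/(congr1 size); rewrite size_map => /size0nil P0.
  by rewrite [P]ncpoly_basis P0 big_nil.
case/mapP=> m hm -> {s} mx.
have : mcoeff (m : seq 'I_N) (f P) = mcoeff m P * mcoeff (m : seq 'I_N) (f (ncmon R m)).
  rewrite triangular_coef (bigD1_seq m) ?fset_uniq //= big1_seq ?addr0 // => t /andP[tm ht].
  have [->|/(f_lead t).1 h] := eqVneq (mcoeff (m : seq 'I_N) (f (ncmon R t))) 0.
    by rewrite mulr0.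
  case/eqP: tm; apply: val_inj; apply: word_le_anti; rewrite h mx //.
  exact: map_f.
rewrite fP0 mcoeff0 => /esym/eqP; rewrite mulf_eq0 mcoeff_eq0 hm /=.
by rewrite gt_eqF // (f_lead m).2.
Qed.

(** The inverse of a triangular map with positive diagonal is again of this kind; the preimages of
    the [e_ R s] will be the orthogonal polynomials. The induction follows the rank of [s]. *)
Lemma triangular_preim s : exists P, f P = e_ R s /\ leading (nccoef P) s.
Proof.
have [n] := ubnP (word_rank s); elim: n s => // n IH s sn.
set x := f (ncmon R s); have [xs x0] : leading (mcoeff^~ x) s := f_lead s.
pose below Q := forall t, nccoef Q t != 0 -> t != s /\ word_le t s.
(* [Q] combines the preimages of all terms of [x] strictly below [s], given by the induction
   hypothesis. *)
have [Q fQ Qs] : exists2 Q,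
    f Q = \sum_(t <- msupp x | t != s) mcoeff t x *: e_ R t & below Q.
  rewrite big_seq_cond; apply: (big_rec (fun y => exists2 Q, f Q = y & below Q)).
    exists 0; first exact: linear0.
    by move=> t; rewrite /nccoef mcoeff0 eqxx.
  move=> t y /andP[]; rewrite -mcoeff_neq0 => /xs ts st [Q fQ Qs].
  have [|P [fP [Pt _]]] := IH t.
    apply: leq_trans (_ : word_rank s <= n)%N; last by rewrite -ltnS.
    rewrite ltnNge word_rank_mono; apply: contra st => lst.
    by apply/eqP; apply: word_le_anti; rewrite ts.
  exists (mcoeff t x *: P + Q); first by rewrite linearP fP fQ.
  move=> u; rewrite nccoef_is_linear.
  have [->|/Pt ut] := eqVneq (nccoef P u) 0; first by rewrite mulr0 add0r; exact: Qs.
  move=> _; split; last exact: word_le_trans ut ts.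
  by apply: contraNneq st => us; apply/eqP; apply: word_le_anti; rewrite ts -us.
(* Subtracting [Q] leaves only the leading term of [x], which is then normalized. *)
exists ((mcoeff s x)^-1 *: (- Q + ncmon R s)); split.
  rewrite linearZ linearD linearN fQ -/x [in X in _ + X](D0_basis x).
  rewrite [X in _ + X](bigD1_seq s) ?fset_uniq -?mcoeff_neq0 ?gt_eqF //=.
  by rewrite addrCA addNr addr0 scalerA mulVf ?gt_eqF // scale1r.
have cE t : nccoef ((mcoeff s x)^-1 *: (- Q + ncmon R s)) t =
    (mcoeff s x)^-1 * ((s == t)%:R - nccoef Q t).
  by rewrite -(nccoef_mon R s t) /nccoef mcoeffZ mcoeffD mcoeffN addrC.
split=> [t|]; rewrite cE.
  have [->|st] := eqVneq s t; first by rewrite word_le_refl.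
  have [->|/Qs[]//] := eqVneq (nccoef Q t) 0.
  by rewrite subr0 mulr0 eqxx.
have [->|/Qs[/eqP]//] := eqVneq (nccoef Q s) 0.
by rewrite eqxx subr0 mulr1 invr_gt0.
Qed.
End Leading.

(** * Extension of isometries to completions *)

Section CompletionMap.
Context (R : realType) (V V' : lmodType R[i]).
Context (ip : {dot V for Num.conj}) (ip' : {dot V' for Num.conj}).
Context (A : {linear V -> V'}) (A_isom : forall x y, ip' (A x) (A y) = ip x y).
Implicit Types (f g : cseq ip) (h k : hcomp ip).

Let map_cauchyb f : A \o f \in cauchyb ip'.
Proof.
apply/asboolP => e /(cseq_cauchy f)[n0 H]; exists n0 => m n hm hn.
by rewrite /= -linearB A_isom H.
Qed.

Definition cseq_map f : cseq ip' := CSeq (map_cauchyb f).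

(** The extension of [A] by continuity, taken termwise on a Cauchy sequence. Since [A] is isometric
    it preserves null sequences, so the choice of representative is immaterial. *)
Definition hcomp_map h : hcomp ip' := hpi (cseq_map (repr h)).

Lemma hcomp_map_pi f : hcomp_map (hpi f) = hpi (cseq_map f).
Proof.
apply/hpi_eq => e e0; have /hpi_eq/(_ e e0)[n0 H] := hpiK (hpi f).
by exists n0 => n /H; rewrite /= -linearB A_isom.
Qed.

Lemma hcomp_map_is_linear : linear hcomp_map.
Proof.
move=> a h k; rewrite -(hpiK h) -(hpiK k).
have -> : a *: hpi (repr h) + hpi (repr k) = hpi (a *: repr h + repr k).
  by rewrite hpiD hpiZ.
rewrite !hcomp_map_pi.
have -> : cseq_map (a *: repr h + repr k) = a *: cseq_map (repr h) + cseq_map (repr k).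
  by apply: val_inj; apply/funext => n; exact: linearP.
by rewrite hpiD hpiZ.
Qed.
HB.instance Definition _ :=
  GRing.isLinear.Build R[i] (hcomp ip) (hcomp ip') *:%R hcomp_map hcomp_map_is_linear.

Lemma hcomp_map_isom h k : hip (hcomp_map h) (hcomp_map k) = hip h k.
Proof.
apply: (cvgC_uniq (hip_pi _ _)); have := hip_repr h k.
by congr cvgC; apply/funext => n; rewrite /= A_isom.
Qed.

Lemma hcomp_map_inc x : hcomp_map (hinc ip x) = hinc ip' (A x).
Proof. by rewrite hcomp_map_pi; congr hpi; exact: val_inj. Qed.
End CompletionMap.

Lemma hcomp_mapK (R : realType) (V V' : lmodType R[i])
    (ip : {dot V for Num.conj}) (ip' : {dot V' for Num.conj})
    (A : {linear V -> V'}) (A_isom : forall x y, ip' (A x) (A y) = ip x y)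
    (B : {linear V' -> V}) (B_isom : forall x y, ip (B x) (B y) = ip' x y) :
  cancel A B -> cancel (hcomp_map A_isom) (hcomp_map B_isom).
Proof.
move=> AK h; rewrite -{1}(hpiK h) !hcomp_map_pi -[RHS]hpiK; congr hpi.
by apply: val_inj; apply/funext => n; exact: AK.
Qed.

(** * Evaluation at the Jacobi operators and the vacuum functional *)

Section JacobiFunctional.
Context (R : realType) (N : nat) (J : 'I_N -> {linear D0 R N -> D0 R N}).
Implicit Types (s t : seq 'I_N) (x y : D0 R N) (P Q : ncpoly R N).

Lemma d0dotPl a x y z : d0dot (a *: x + y) z = a * d0dot x z + d0dot y z.
Proof. exact: (d0dot_bilinear R N).1. Qed.

Lemma d0dotPr a x y z : d0dot z (a *: x + y) = a^* * d0dot z x + d0dot z y.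
Proof. exact: (d0dot_bilinear R N).2. Qed.

Lemma ncpoly_ind (S : ncpoly R N -> Prop) :
  S 0 -> (forall a P Q, S P -> S Q -> S (a *: P + Q)) -> (forall s, S (ncmon R s)) ->
  forall P, S P.
Proof.
move=> S0 SD Smon P; rewrite [P]ncpoly_basis; apply: (big_rec S) => // m Q _ SQ.
exact: SD.
Qed.

Lemma ncinv_mon s : ncinv (ncmon R s) = ncmon R (rev s).
Proof.
apply: ncpolyP => t; rewrite nccoef_inv !nccoef_mon rmorph_nat.
by rewrite -(inj_eq (can_inj revK)) revK.
Qed.

Lemma ncinv0 : ncinv 0 = 0 :> ncpoly R N.
Proof.
by apply: ncpolyP => t; rewrite nccoef_inv /nccoef !mcoeff0 rmorph0.
Qed.

(** With [foldr] the first letter acts last, as in the operator product matching [ncmon R s]. *)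
Definition jword s x : D0 R N := foldr (fun k y => J k y) x s.

(** This is P(J_1, ..., J_N) applied to the vacuum vector. *)
Definition vacuum_eval : ncpoly R N -> D0 R N :=
  malg_lift (fun m : {fmonom 'I_N} => jword m (e_ R [::])).
HB.instance Definition _ := GRing.Linear.on vacuum_eval.
Local Notation ev := vacuum_eval.

Lemma vacuum_evalP a P Q : ev (a *: P + Q) = a *: ev P + ev Q.
Proof. exact: malg_lift_is_linear. Qed.

Lemma vacuum_eval0 : ev 0 = 0.
Proof. exact: linear0. Qed.

Lemma vacuum_eval_mon s : ev (ncmon R s) = jword s (e_ R [::]).
Proof. exact: malg_liftU. Qed.

Lemma vacuum_eval_mul k P : ev (ncmon R [:: k] * P) = J k (ev P).
Proof.
elim/ncpoly_ind: P => [|a P Q hP hQ|s].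
- by rewrite mulr0 vacuum_eval0 linear0.
- have -> : ncmon R [:: k] * (a *: P + Q) = a *: (ncmon R [:: k] * P) + ncmon R [:: k] * Q.
    by rewrite mulrDr ncpoly_scalerAr.
  (* Explicit terms, because rewriting with hP makes unification unfold products. *)
  have lP := vacuum_evalP a (ncmon R [:: k] * P) (ncmon R [:: k] * Q).
  have rP := etrans (congr1 (J k) (vacuum_evalP a P Q)) (linearP (J k) a (ev P) (ev Q)).
  exact: etrans lP (etrans (congr2 (fun x y => a *: x + y) hP hQ) (esym rP)).
by rewrite -ncmonM !vacuum_eval_mon.
Qed.

Lemma vacuum_eval_mulw s P : ev (ncmon R s * P) = jword s (ev P).
Proof.
elim: s => [|k s IH]; first by rewrite ncmon_nil mul1r.
by rewrite -cat1s ncmonM -mulrA vacuum_eval_mul IH.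
Qed.

Lemma vacuum_eval_lead :
  (forall k x s, leading (mcoeff^~ x) s -> leading (mcoeff^~ (J k x)) (k :: s)) ->
  forall s, leading (mcoeff^~ (ev (ncmon R s))) s.
Proof.
move=> Jlead s; rewrite vacuum_eval_mon; elim: s => [|k s IH] /=; last exact: Jlead.
split=> [t|]; rewrite mcoeffU ?eqxx ?ltr01 //.
by have [<-|] := eqVneq [::] t; rewrite ?word_le_refl ?eqxx.
Qed.

Hypothesis J_sym : forall k x y, d0dot (J k x) y = d0dot x (J k y).

(** The adjoint of a product of symmetric operators is the product in reverse order. *)
Lemma jword_adj s x y : d0dot (jword (rev s) x) y = d0dot x (jword s y).
Proof.
elim: s x => //= k s IH x.
by rewrite rev_cons /jword foldr_rcons -/(jword _ _) IH J_sym.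
Qed.

(** Both sides are conjugate-linear in [Q], which reduces to words. There [ncinv] reverses the word
    and [jword_adj] moves the operators across. *)
Lemma vacuum_eval_inv P Q : d0dot (ev (ncinv Q * P)) (e_ R [::]) = d0dot (ev P) (ev Q).
Proof.
elim/ncpoly_ind: Q => [|a Q Q' hQ hQ'|s].
- by rewrite ncinv0 mul0r vacuum_eval0 (linear0l (@d0dot R N)) (linear0r (@d0dot R N)).
- have -> : ncinv (a *: Q + Q') * P = a^* *: (ncinv Q * P) + ncinv Q' * P.
    by rewrite ncinv_is_linear mulrDl scalerAl.
  have lP := vacuum_evalP a^* (ncinv Q * P) (ncinv Q' * P).
  have rP := vacuum_evalP a Q Q'.
  have key (x y p z w v : D0 R N) : d0dot x v = d0dot p z -> d0dot y v = d0dot p w ->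
      d0dot (a^* *: x + y) v = d0dot p (a *: z + w).
    by move=> hx hy; rewrite d0dotPl d0dotPr hx hy.
  rewrite lP rP; exact: key hQ hQ'.
by rewrite ncinv_mon vacuum_eval_mulw jword_adj vacuum_eval_mon.
Qed.

Definition vacuum_state P : R[i] := d0dot (ev P) (e_ R [::]).

Lemma vacuum_state_is_linear : scalar vacuum_state.
Proof. by move=> a P Q; rewrite /vacuum_state vacuum_evalP d0dotPl. Qed.
HB.instance Definition _ :=
  GRing.isLinear.Build R[i] (ncpoly R N) R[i] *%R vacuum_state vacuum_state_is_linear.

Lemma vacuum_state1 : vacuum_state 1 = 1.
Proof. by rewrite /vacuum_state -ncmon_nil vacuum_eval_mon d0dot_e eqxx. Qed.

(** The value at [ncinv P * P] is the squared norm of [vacuum_eval J P]. *)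
Lemma vacuum_state_pos : (forall P, ev P = 0 -> P = 0) ->
  forall P, P != 0 -> 0 < vacuum_state (ncinv P * P).
Proof.
move=> ev_inj P P0; rewrite /vacuum_state vacuum_eval_inv; apply: d0dot_gt0.
by apply: contra P0 => /eqP/ev_inj->.
Qed.
End JacobiFunctional.

(** Recovers the polynomial hidden by the existential in [Psi] from its image in the completion. *)
Lemma hinc_inj (R : realType) (V : lmodType R[i]) (ip : {dot V for Num.conj}) :
  injective (hinc ip).
Proof.
move=> x y xy; have h0 : hinc ip (x - y) = 0 by rewrite linearB /= xy subrr.
apply/eqP; rewrite -subr_eq0; apply/negPn/negP.
by rewrite -(dnorm_gt0 ip) -(hinc_isom ip) h0 (linear0r (@hip R V ip)) ltxx.
Qed.

(** * Uniqueness of the functional *)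

Section Uniqueness.
Context (R : realType) (N : nat) (J : 'I_N -> {linear D0 R N -> D0 R N}).

Lemma realizes_vacuum_state (psi : spfunctional R N) :
  realizes psi J -> psi =1 vacuum_state J.
Proof.
case=> f [[f_le f_pos f_orth]] [W] [Winv] [[W_isom WK WinvK] We WJ].
have f0 : f [::] = 1.
  (* No other word precedes the empty one, so [f [::]] is a constant; norm one and positivity then
     make it 1. *)
  have f0E : f [::] = nccoef (f [::]) [::] *: ncmon R [::].
    apply: ncpolyP => t; rewrite [RHS](mcoeffZ _ _ (FMonom t)).
    rewrite -[mcoeff _ (ncmon R _)]/(nccoef _ t) nccoef_mon.
    have [<-|t0] := eqVneq [::] t; first by rewrite mulr1.
    rewrite mulr0; apply/eqP/negPn/negP => /f_le.
    by case: t t0.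
  have := f_orth [::] [::]; rewrite f0E eqxx.
  have a0 := f_pos [::]; set a := nccoef _ _ in a0 *.
  have -> (P : ncpoly R N) : phidot psi (a *: P) (a *: P) = a * (a^* * phidot psi P P).
    by rewrite -(ipZr (phidot psi)) -(ipZl (phidot psi)).
  rewrite geC0_conj ?ltW //.
  have -> : phidot psi (ncmon R [::]) (ncmon R [::]) = 1.
    by rewrite /phidot ncinv_mon ncmon_nil mulr1 sp_unital.
  rewrite mulr1 -expr2 => /eqP; rewrite sqrp_eq1 ?ltW // => /eqP->.
  by rewrite scale1r ncmon_nil.
have Wmon s : W (hinj (fock R N) (vacuum_eval J (ncmon R s))) = hinj (Hphi psi) (ncmon R s).
  elim: s => [|k s IH]; first by rewrite vacuum_eval_mon We f0 ncmon_nil.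
  rewrite -cat1s ncmonM vacuum_eval_mul.
  have [h [P hP ->] ->] := WJ k (vacuum_eval J (ncmon R s)).
  (* By the induction hypothesis and [hinc_inj], the polynomial [P] supplied by [Psi] is
     [ncmon R s]. *)
  rewrite WinvK; congr (hinj _ (_ * _)); apply: (@hinc_inj _ _ (phidot psi)).
  by rewrite -[LHS]hP IH.
have WE P : W (hinj (fock R N) (vacuum_eval J P)) = hinj (Hphi psi) P.
  elim/ncpoly_ind: P => [|a P Q hP hQ|//].
    by rewrite vacuum_eval0 !linear0.
  rewrite (vacuum_evalP J a P Q).
  have l1 := linearP (hinj (fock R N)) a (vacuum_eval J P) (vacuum_eval J Q).
  have l2 := linearP W a (hinj (fock R N) (vacuum_eval J P))
    (hinj (fock R N) (vacuum_eval J Q)).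
  have l3 := linearP (hinj (Hphi psi)) a P Q.
  have l4 := congr2 (fun x y => a *: x + y) hP hQ.
  exact: etrans (congr1 W l1) (etrans l2 (etrans l4 (esym l3))).
(* Writing [psi P] as an inner product with 1 lets the isometry [W] carry it back to the Fock
   space. *)
move=> P; have -> : psi P = phidot psi P 1.
  by rewrite /phidot -ncmon_nil ncinv_mon ncmon_nil mul1r.
rewrite -(hinj_isom (Hphi psi)) -(WE P) -ncmon_nil -(WE (ncmon R [::])) W_isom.
by rewrite (hinj_isom (fock R N)) vacuum_eval_mon.
Qed.
End Uniqueness.

(** * Existence and uniqueness of the functional for the Jacobi family *)

Theorem theorem9 (R : realType) (N : nat) (J : 'I_N -> {linear D0 R N -> D0 R N})
  (J_jacobi : jacobi_family J)
  (B_triangular : forall n : nat, upper_triangular (jacobi_Brow J n))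
  (B_invertible : forall n : nat, jacobi_Brow J n \in unitmx)
  (B_diag_pos : forall (n : nat) (i : 'I_(N ^ n.+1)), 0 < jacobi_Brow J n i i) :
  exists phi : spfunctional R N,
    realizes phi J /\
    (forall psi : spfunctional R N, realizes psi J -> psi =1 phi).
Proof.
have J_sym k x y : d0dot (J k x) y = d0dot x (J k y) by have [] := J_jacobi k.
have J_block k m n : (m.+1 < n)%N || (n.+1 < m)%N -> coef_block (J k) m n = 0.
  by have [_ /(_ m n)] := J_jacobi k.
have ev_lead := vacuum_eval_lead (jacobi_lead J_block B_triangular B_diag_pos).
have ev_inj := triangular_inj ev_lead.
have /choice[f f_spec] := triangular_preim ev_lead.
pose phi := SPFunctional (sp_fun := vacuum_state J) (vacuum_state1 J)
  (vacuum_state_pos J_sym ev_inj).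
exists phi; split; last exact: realizes_vacuum_state.
have phidotE P Q : phidot phi P Q = d0dot (vacuum_eval J P) (vacuum_eval J Q).
  exact: vacuum_eval_inv.
(* [g] is the inverse of [vacuum_eval J]; its extension will be [W], and that of [vacuum_eval J] the
   inverse of [W]. *)
pose g : {linear D0 R N -> ncpoly R N} := malg_lift f.
have evK x : vacuum_eval J (g x) = x.
  transitivity (\sum_(t <- msupp x) mcoeff t x *: vacuum_eval J (f t)).
    apply: etrans (linear_sum _ _ _ _) _.
    by apply: eq_bigr => t _; exact: linearZ.
  rewrite [RHS]D0_basis; apply: eq_bigr => t _; congr (_ *: _).
  exact: (f_spec t).1.
have gK P : g (vacuum_eval J P) = P.
  (* A right inverse of an injective linear map is also a left inverse. *)
  apply/eqP; rewrite -subr_eq0; apply/eqP/ev_inj.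
  rewrite linearB; apply/eqP; rewrite subr_eq0; apply/eqP; exact: evK.
have g_isom x y : phidot phi (g x) (g y) = d0dot x y.
  exact: etrans (phidotE (g x) (g y)) (congr2 (@d0dot R N) (evK x) (evK y)).
have ev_isom P Q : d0dot (vacuum_eval J P) (vacuum_eval J Q) = phidot phi P Q.
  by rewrite phidotE.
exists f; split.
  split=> [s t|s|s t]; [exact: (f_spec s).2.1|exact: (f_spec s).2.2|].
  by rewrite phidotE !(f_spec _).1 d0dot_e.
exists (hcomp_map g_isom), (hcomp_map ev_isom); split.
- split; first exact: hcomp_map_isom.
    exact: hcomp_mapK evK.
  exact: hcomp_mapK gK.
- move=> s; apply: etrans (hcomp_map_inc g_isom (e_ R s)) _.
  by congr hinc; exact: malg_liftU.
(* [W] sends [x] to the polynomial [g x], so [Psi] acts on it by multiplication by Y_k, which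
   [vacuum_eval J] turns back into [J k]. *)
move=> k x; exists (hinj (Hphi phi) (ncmon R [:: k] * g x)).
  by exists (g x) => //; exact: hcomp_map_inc.
apply: esym; apply: etrans (hcomp_map_inc ev_isom _) _.
congr hinc; apply: etrans (vacuum_eval_mul J k (g x)) _.
by rewrite evK.
Qed.
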